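(* Let $\boldsymbol A(\mathfrak C)=\mathfrak C^*$ be a regular (branched or unbranched) covering, $\mathfrak C$ connected, $\mathfrak C^*$ with a single point; let $p_0$ be a point of $\mathfrak C$, $\mathfrak W_0$ the fundamental group of $\mathfrak C$ with basepoint $p_0$, $\mathfrak T$ the group of mappings of $\mathfrak C$ onto itself belonging to the covering, $\mathfrak V$ the principal group of the covering, and $\mathfrak U$ the subgroup of $\mathfrak V$ determined by those paths of the universal covering complex $\mathfrak K$ of $\mathfrak C$ that begin and end at points lying over $p_0$. Then $\mathfrak U$ is isomorphic to $\mathfrak W_0$, $\mathfrak U$ is an invariant (normal) subgroup of $\mathfrak V$, and $\mathfrak T$ is isomorphic to the factor group $\mathfrak V/\mathfrak U$.
   Context: A line segment complex consists of (finitely or denumerably many) points and directed segments; each segment $s$ has an initial and a final point and an oppositely directed segment $s^{-1}\ne s$, with $(s^{-1})^{-1}=s$, whose initial (final) point is the final (initial) point of $s$. Paths are finite sequences of segments, each beginning where the preceding one ends. A surface complex is a line segment complex together with surface pieces $f$; each $f$ has an opposite $f^{-1}\neq f$, $(f^{-1})^{-1}=f$, and a closed path, determined up to cyclic interchange, circumscribing $f$ once positively (a simple positive boundary path of $f$); if $w$ is one for $f$, then $w^{-1}$ is one for $f^{-1}$. The fundamental group of a connected surface complex consists of closed paths from a basepoint modulo insertion and deletion of $ss^{-1}$ and of simple boundary paths of surface pieces. Covering (possibly branched) $\boldsymbol A(\mathfrak C)=\mathfrak C^*$ of surface complexes: a map of points, segments, surface pieces, surjective on points, such that (a) initial points are preserved,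 $\boldsymbol A(s^{-1})=\boldsymbol A(s)^{-1}$, $\boldsymbol A(f^{-1})=\boldsymbol A(f)^{-1}$, and the segments beginning at $p$ are mapped bijectively onto those beginning at $\boldsymbol A(p)$; (b) if $r$ is a simple positive boundary path of $f$, then $\boldsymbol A(r)={r^*}^k$ for a simple positive boundary path $r^*$ of $\boldsymbol A(f)$, and, writing $r=w_1\cdots w_k$ with $\boldsymbol A(w_i)=r^*$, the $w_i$ are pairwise distinct; (c) if $r^*$ is a simple positive boundary path of $f^*$ and $w'$ is a path with $\boldsymbol A(w')=r^*$, there is exactly one surface piece $f'$ over $f^*$ in whose simple positive boundary path $r'$ (suitably cyclically interchanged) $w'$ occurs as initial subpath. In $\mathfrak C^*$ each simple positive boundary path of a surface piece $f^*$ is assumed to bound only this surface piece positively. The covering is regular if, whenever $\boldsymbol A(w)=\boldsymbol A(w')$ and the path $w$ is closed, $w'$ is closed. The group $\mathfrak T$ consists of the automorphisms of the line segment complex of $\mathfrak C$ (which extend to $\mathfrak C$) that carry every element to one lying over the same element of $\mathfrak C^*$. The universal covering complex $\mathfrak K$ of $\mathfrak C$, with covering $\boldsymbol A'$, is the connected unbranched covering complex in which a path is closed iff its image in $\mathfrak C$ is closed and represents the identity of the fundamental group of $\mathfrak C$. Let $\boldsymbol A''=\boldsymbol A\circ\boldsymbol A'$, a regular covering of $\mathfrak C^*$ by $\mathfrak K$. If $s_1^{*\pm1},s_2^{*\pm1},\dots$ are the segments of $\mathfrak C^*$, the principal group $\mathfrak V$ is the factor group of the free group on $S_1,S_2,\dots$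 by the normal subgroup of those words $W(S)$ for which the paths of $\mathfrak K$ lying (under $\boldsymbol A''$) over $W(s^* )$ are closed. $\mathfrak U$ consists of the elements of $\mathfrak V$ represented by the words obtained from $\boldsymbol A''(w)=w^*(s^* )$ by replacing $s_i^*$ by $S_i$, where $w$ runs through the paths of $\mathfrak K$ that begin and end at points $p$ with $\boldsymbol A'(p)=p_0$. *)

(* Defs.v *)
From HB Require Import structures.
From Stdlib Require Import Relations.
From mathcomp Require Import all_boot.
From mathcomp Require Import boolp.

Set Implicit Arguments.
Unset Strict Implicit.
Unset Printing Implicit Defensive.

Local Open Scope group_scope.
Local Open Scope quotient_scope.

Definition isomorphic (G H : groupType) : Prop :=
  exists f : {multiplicative G -> H}, bijective f.

(* A set with operations that satisfy the group laws up to an equivalence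
   relation; free groups, fundamental groups and factor groups are all obtained
   by passing to classes. *)
Record preGroup := PreGroup {
  pre_sort :> choiceType;
  pre_one : pre_sort;
  pre_inv : pre_sort -> pre_sort;
  pre_mul : pre_sort -> pre_sort -> pre_sort;
  pre_eq : pre_sort -> pre_sort -> Prop;
  pre_eq_refl : forall x, pre_eq x x;
  pre_eq_sym : forall x y, pre_eq x y -> pre_eq y x;
  pre_eq_trans : forall x y z, pre_eq x y -> pre_eq y z -> pre_eq x z;
  pre_mul_eq : forall x x' y y',
    pre_eq x x' -> pre_eq y y' -> pre_eq (pre_mul x y) (pre_mul x' y');
  pre_mulA : forall x y z,
    pre_eq (pre_mul x (pre_mul y z)) (pre_mul (pre_mul x y) z);
  pre_mul1 : forall x, pre_eq (pre_mul pre_one x) x;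
  pre_mulr1 : forall x, pre_eq (pre_mul x pre_one) x;
  pre_mulV : forall x, pre_eq (pre_mul (pre_inv x) x) pre_one;
  pre_mulrV : forall x, pre_eq (pre_mul x (pre_inv x)) pre_one
}.

Section Classes.
Variable P : preGroup.

Definition pre_rel : rel P := fun x y => `[< pre_eq x y >].

Fact pre_rel_refl : reflexive pre_rel.
Proof. by move=> x; apply/asboolP/pre_eq_refl. Qed.

Fact pre_rel_sym : symmetric pre_rel.
Proof. by move=> x y; apply/asboolP/asboolP; apply: pre_eq_sym. Qed.

Fact pre_rel_trans : transitive pre_rel.
Proof.
move=> y x z /asboolP xy /asboolP yz; apply/asboolP; exact: pre_eq_trans xy yz.
Qed.

Canonical pre_equiv := EquivRel pre_rel pre_rel_refl pre_rel_sym pre_rel_trans.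

Definition classes := {eq_quot pre_equiv}.
HB.instance Definition _ := Choice.on classes.
HB.instance Definition _ := Quotient.on classes.

Definition class (x : P) : classes := \pi_classes x.

Lemma classP (x y : P) : class x = class y <-> pre_eq x y.
Proof.
by split=> [/eqmodP/asboolP //|xy]; apply/eqmodP/asboolP.
Qed.

Lemma classW (X : classes) : exists x, X = class x.
Proof. by exists (repr X); rewrite /class reprK. Qed.

Definition classes_one : classes := class (pre_one P).
Definition classes_inv (X : classes) : classes := class (pre_inv (repr X)).
Definition classes_mul (X Y : classes) : classes :=
  class (pre_mul (repr X) (repr Y)).

Lemma repr_class (x : P) : pre_eq (repr (class x)) x.
Proof. by apply/classP; rewrite /class reprK. Qed.

Lemma classes_mulE (x y : P) :
  classes_mul (class x) (class y) = class (pre_mul x y).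
Proof. by apply/classP/pre_mul_eq; apply: repr_class. Qed.

Fact classes_mulA : associative classes_mul.
Proof.
move=> X Y Z; have [x ->] := classW X; have [y ->] := classW Y.
have [z ->] := classW Z; rewrite !classes_mulE; exact/classP/pre_mulA.
Qed.

Fact classes_mul1 : left_id classes_one classes_mul.
Proof.
by move=> X; have [x ->] := classW X; rewrite classes_mulE; apply/classP/pre_mul1.
Qed.

Fact classes_mulr1 : right_id classes_one classes_mul.
Proof.
by move=> X; have [x ->] := classW X; rewrite classes_mulE; apply/classP/pre_mulr1.
Qed.

Fact classes_mulV : left_inverse classes_one classes_inv classes_mul.
Proof.
move=> X; rewrite -{2}[X](reprK X) -/(class _) /classes_inv classes_mulE.
exact/classP/pre_mulV.
Qed.

Fact classes_mulrV : right_inverse classes_one classes_inv classes_mul.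
Proof.
move=> X; rewrite -{1}[X](reprK X) -/(class _) /classes_inv classes_mulE.
exact/classP/pre_mulrV.
Qed.

HB.instance Definition _ := isGroup.Build classes
  classes_mulA classes_mul1 classes_mulr1 classes_mulV classes_mulrV.

Lemma classM (x y : P) : class (pre_mul x y) = class x * class y.
Proof. by rewrite -classes_mulE. Qed.

Lemma class1 : class (pre_one P) = 1.
Proof. by []. Qed.

Lemma classV (x : P) : class (pre_inv x) = (class x)^-1.
Proof.
apply: (@mulgI _ (class x)); rewrite mulgV -classM -class1.
exact/classP/pre_mulrV.
Qed.

End Classes.

Definition normal (G : groupType) (S : {pred G}) : Prop :=
  forall x y, x \in S -> x ^ y \in S.

Section FactorGroup.
Variables (G : groupType) (S : groupClosed G) (nS : normal S).

Definition coset_eq (x y : G) : Prop := x^-1 * y \in S.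

Fact coset_eq_refl x : coset_eq x x.
Proof. by rewrite /coset_eq mulVg gpred1. Qed.

Fact coset_eq_sym x y : coset_eq x y -> coset_eq y x.
Proof. by rewrite /coset_eq => ?; rewrite -gpredV invgM invgK. Qed.

Fact coset_eq_trans x y z : coset_eq x y -> coset_eq y z -> coset_eq x z.
Proof.
by rewrite /coset_eq => xy yz; have := gpredM _ _ xy yz; rewrite mulgA mulgK.
Qed.

Fact coset_eq_mul x x' y y' :
  coset_eq x x' -> coset_eq y y' -> coset_eq (x * y) (x' * y').
Proof.
rewrite /coset_eq => /(nS y) xx' yy'; have := gpredM _ _ xx' yy'.
by rewrite /conjg invgM !mulgA mulgK.
Qed.

Fact coset_eqW x y : x = y -> coset_eq x y.
Proof. by move->; apply: coset_eq_refl. Qed.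

Definition coset_pre : preGroup :=
  @PreGroup G 1 inv mul coset_eq coset_eq_refl coset_eq_sym coset_eq_trans
    coset_eq_mul (fun x y z => coset_eqW (mulgA x y z))
    (fun x => coset_eqW (mul1g x)) (fun x => coset_eqW (mulg1 x))
    (fun x => coset_eqW (mulVg x)) (fun x => coset_eqW (mulgV x)).

Definition factorGroup : groupType := classes coset_pre.

End FactorGroup.

Arguments factorGroup {G S}.

Section SubgroupType.
Variables (G : groupType) (S : groupClosed G).

Definition subgroup_of := {x : G | x \in S}.
HB.instance Definition _ := SubChoice.on subgroup_of.

Fact subgroup_closed : group_closed S.
Proof. by split; [exact: gpred1 | move=> x y xS yS; exact: gpredF]. Qed.

HB.instance Definition _ :=
  SubChoice_isSubGroup.Build G (fun x => x \in S) subgroup_of subgroup_closed.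

Definition subgroup : groupType := subgroup_of.

End SubgroupType.

Section FreeGroup.
Variable I : countType.

(* The letter (i, true) is S_i, the letter (i, false) is its inverse. *)
Definition letter : countType := (I * bool)%type.
Definition letter_inv (x : letter) : letter := (x.1, ~~ x.2).
Definition word : countType := seq letter.
Definition word_inv (W : word) : word := rev (map letter_inv W).

Variant word_step : word -> word -> Prop :=
  WordStep (u v : word) x : word_step (u ++ v) (u ++ x :: letter_inv x :: v).

Definition word_eq : word -> word -> Prop := clos_refl_sym_trans _ word_step.

Lemma letter_invK : involutive letter_inv.
Proof. by case=> i b; rewrite /letter_inv /= negbK. Qed.

Lemma word_invK : involutive word_inv.
Proof.
by move=> W; rewrite /word_inv map_rev revK mapK //; exact: letter_invK.
Qed.

Fact word_eq_cat u u' v v' :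
  word_eq u u' -> word_eq v v' -> word_eq (u ++ v) (u' ++ v').
Proof.
move=> uu' vv'; apply: (rst_trans _ _ _ (u' ++ v)).
  elim: uu' => [_ _ [a b x]|?|? ? _|? y ? _ ? _ ?].
  - by rewrite -!catA; apply/rst_step/(@WordStep a (b ++ v) x).
  - exact: rst_refl.
  - exact: rst_sym.
  - exact: rst_trans (y ++ v) _ _ _.
elim: vv' => [_ _ [a b x]|?|? ? _|? y ? _ ? _ ?].
- by rewrite !catA; apply/rst_step/(@WordStep (u' ++ a) b x).
- exact: rst_refl.
- exact: rst_sym.
- exact: rst_trans (u' ++ y) _ _ _.
Qed.

Fact word_eqW u v : u = v -> word_eq u v.
Proof. by move->; apply: rst_refl. Qed.

Fact word_mulV W : word_eq (word_inv W ++ W) [::].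
Proof.
elim: W => [|x W IH]; first exact: rst_refl.
apply: rst_trans IH; apply/rst_sym/rst_step.
rewrite /word_inv /= rev_cons cat_rcons.
by rewrite -{2}[x]letter_invK; apply: WordStep.
Qed.

Fact word_mulrV W : word_eq (W ++ word_inv W) [::].
Proof. by rewrite -{1}[W]word_invK; apply: word_mulV. Qed.

Definition free_pre : preGroup :=
  @PreGroup word [::] word_inv cat word_eq
    (@rst_refl _ _) (@rst_sym _ _) (@rst_trans _ _) word_eq_cat
    (fun u v w => word_eqW (catA u v w)) (fun u => word_eqW (cat0s u))
    (fun u => word_eqW (cats0 u)) word_mulV word_mulrV.

Definition freeGroup : groupType := classes free_pre.

Definition word_class (W : word) : freeGroup := @class free_pre W.

Lemma word_classM U V : word_class (U ++ V) = word_class U * word_class V.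
Proof. exact: (@classM free_pre). Qed.

Lemma word_class1 : word_class [::] = 1.
Proof. by []. Qed.

Lemma word_classV W : word_class (word_inv W) = (word_class W)^-1.
Proof. exact: (@classV free_pre). Qed.

End FreeGroup.

Record lineComplex := LineComplex {
  pnt : countType;
  seg : countType;
  ini : seg -> pnt;
  fin : seg -> pnt;
  opp : seg -> seg;
  oppK : involutive opp;
  opp_neq : forall s, opp s <> s;
  ini_opp : forall s, ini (opp s) = fin s;
  fin_opp : forall s, fin (opp s) = ini s
}.

(* [joins p w q]: the sequence w of segments is a path from p to q. *)
Fixpoint joins (L : lineComplex) (p : pnt L) (w : seq (seg L)) (q : pnt L) :
    bool :=
  if w is s :: w' then (ini s == p) && joins (fin s) w' q else p == q.

Definition connected (L : lineComplex) : Prop :=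
  forall p q : pnt L, exists w, joins p w q.

Definition path_inv (L : lineComplex) (w : seq (seg L)) : seq (seg L) :=
  rev (map (@opp L) w).

Definition cyclic_interchange (L : lineComplex)
    (p : pnt L) (r : seq (seg L)) (p' : pnt L) (r' : seq (seg L)) : Prop :=
  exists u v, [/\ r = u ++ v, r' = v ++ u & joins p u p'].

(* [bdry f p r]: the path r starting at p is a simple positive boundary path
   of f.  The base point only carries information when r is empty. *)
Record surfaceComplex := SurfaceComplex {
  line :> lineComplex;
  face : Type;
  fopp : face -> face;
  fopp_neq : forall f, fopp f <> f;
  foppK : involutive fopp;
  bdry : face -> pnt line -> seq (seg line) -> Prop;
  bdry_ex : forall f, exists p r, bdry f p r;
  bdry_closed : forall f p r, bdry f p r -> joins p r p;
  bdry_cyclic : forall f p r, bdry f p r ->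
    forall p' r', bdry f p' r' <-> cyclic_interchange p r p' r';
  bdry_opp : forall f p r, bdry f p r -> bdry (fopp f) p (path_inv r)
}.

Section PathLemmas.
Variable L : lineComplex.
Implicit Types (p q : pnt L) (w : seq (seg L)).

Lemma joins_cat p u v q :
  joins p (u ++ v) q <-> exists2 x, joins p u x & joins x v q.
Proof.
elim: u p => [|s u IH] p /=; first by split=> [|[x /eqP-> //]]; exists p.
split=> [/andP[-> /IH //]|[x /andP[-> ux] vx]].
by rewrite /=; apply/IH; exists x.
Qed.

Lemma joins_fun p w q q' : joins p w q -> joins p w q' -> q = q'.
Proof.
elim: w p => [|s w IH] p /=; first by move=> /eqP <- /eqP.
by move=> /andP[_ h] /andP[_ h']; apply: IH h h'.
Qed.

Lemma path_invK : involutive (@path_inv L).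
Proof. by move=> w; rewrite /path_inv map_rev revK mapK //; exact: oppK. Qed.

Lemma path_inv_cat u v : path_inv (u ++ v) = path_inv v ++ path_inv u :> seq (seg L).
Proof. by rewrite /path_inv map_cat rev_cat. Qed.

Lemma joins_inv p w q : joins p w q -> joins q (path_inv w) p.
Proof.
elim: w p => [|s w IH] p /=; first by move/eqP->; rewrite /= eqxx.
case/andP=> /eqP <- /IH h; rewrite -cat1s path_inv_cat; apply/joins_cat.
by exists (fin s) => //=; rewrite ini_opp fin_opp !eqxx.
Qed.

End PathLemmas.

Section FundamentalGroup.
Variables (C : surfaceComplex) (p : pnt C).

Definition loop := {w : seq (seg C) | joins p w p}.
HB.instance Definition _ := SubChoice.on loop.

Variant homotopy_step : seq (seg C) -> seq (seg C) -> Prop :=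
| SpurStep u v s of joins p u (ini s) :
    homotopy_step (u ++ v) (u ++ s :: opp s :: v)
| FaceStep u v q f r of joins p u q & bdry f q r :
    homotopy_step (u ++ v) (u ++ r ++ v).

Definition homotopic : seq (seg C) -> seq (seg C) -> Prop :=
  clos_refl_sym_trans _ homotopy_step.

Definition loop_eq (l l' : loop) : Prop := homotopic (val l) (val l').

Fact loop1_subproof : joins p [::] p.
Proof. exact: eqxx. Qed.
Definition loop1 : loop := exist (fun w => joins p w p) [::] loop1_subproof.

Fact loopM_subproof (l l' : loop) : joins p (val l ++ val l') p.
Proof. by apply/joins_cat; exists p; [exact: valP l | exact: valP l']. Qed.
Definition loopM (l l' : loop) : loop :=
  exist (fun w => joins p w p) _ (loopM_subproof l l').

Fact loopV_subproof (l : loop) : joins p (path_inv (val l)) p.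
Proof. exact/joins_inv/(valP l). Qed.
Definition loopV (l : loop) : loop :=
  exist (fun w => joins p w p) _ (loopV_subproof l).

Fact loop_eq_refl l : loop_eq l l. Proof. exact: rst_refl. Qed.
Fact loop_eq_sym l l' : loop_eq l l' -> loop_eq l' l.
Proof. exact: rst_sym. Qed.
Fact loop_eq_trans x y z : loop_eq x y -> loop_eq y z -> loop_eq x z.
Proof. exact: rst_trans. Qed.

Lemma homotopic_catr v w w' :
  homotopic w w' -> homotopic (w ++ v) (w' ++ v).
Proof.
elim=> [_ _ [a b s h|a b q f r h hr]|?|? ? _|? t ? _ ? _ ?].
- by rewrite -!catA; apply: rst_step; apply: (@SpurStep a (b ++ v) s).
- by rewrite -!catA; apply: rst_step; apply: (@FaceStep a (b ++ v) q f r).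
- exact: rst_refl.
- exact: rst_sym.
- exact: rst_trans (t ++ v) _ _ _.
Qed.

Lemma homotopic_catl u w w' :
  joins p u p -> homotopic w w' -> homotopic (u ++ w) (u ++ w').
Proof.
move=> hu; elim=> [_ _ [a b s h|a b q f r h hr]|?|? ? _|? t ? _ ? _ ?].
- rewrite !catA; apply: rst_step; apply: (@SpurStep (u ++ a) b s).
  by apply/joins_cat; exists p.
- rewrite !catA -(catA _ r); apply: rst_step.
  apply: (@FaceStep (u ++ a) b q f r) => //.
  by apply/joins_cat; exists p.
- exact: rst_refl.
- exact: rst_sym.
- exact: rst_trans (u ++ t) _ _ _.
Qed.

Fact loop_eq_mul x x' y y' :
  loop_eq x x' -> loop_eq y y' -> loop_eq (loopM x y) (loopM x' y').
Proof.
move=> xx' yy'; apply: (rst_trans _ _ _ (val x' ++ val y)).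
  exact: homotopic_catr.
by apply: homotopic_catl => //; apply: valP x'.
Qed.

Fact loop_eqW l l' : val l = val l' -> loop_eq l l'.
Proof. by rewrite /loop_eq => ->; apply: rst_refl. Qed.

Fact loop_mulA x y z : loop_eq (loopM x (loopM y z)) (loopM (loopM x y) z).
Proof. exact/loop_eqW/catA. Qed.
Fact loop_mul1 x : loop_eq (loopM loop1 x) x. Proof. exact/loop_eqW. Qed.
Fact loop_mulr1 x : loop_eq (loopM x loop1) x.
Proof. exact/loop_eqW/cats0. Qed.

Lemma homotopic_invl w q : joins q w p -> homotopic (path_inv w ++ w) [::].
Proof.
elim: w q => [|s w IH] q /=; first by move=> _; apply: rst_refl.
case/andP=> _ h; apply: rst_trans (IH _ h); apply/rst_sym/rst_step.
rewrite -cat1s path_inv_cat -catA /= -{2}[s](oppK s); apply: SpurStep.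
by rewrite ini_opp; apply: joins_inv.
Qed.

Fact loop_mulV x : loop_eq (loopM (loopV x) x) loop1.
Proof. exact: homotopic_invl (valP x). Qed.

Fact loop_mulrV x : loop_eq (loopM x (loopV x)) loop1.
Proof.
rewrite /loop_eq /= -{1}[val x]path_invK.
exact: homotopic_invl (valP (loopV x)).
Qed.

Definition loop_pre : preGroup :=
  @PreGroup loop loop1 loopV loopM loop_eq
    loop_eq_refl loop_eq_sym loop_eq_trans loop_eq_mul
    loop_mulA loop_mul1 loop_mulr1 loop_mulV loop_mulrV.

Definition fundamentalGroup : groupType := classes loop_pre.

Definition loop_class (l : loop) : fundamentalGroup := @class loop_pre l.

End FundamentalGroup.

Definition nullhomotopic (C : surfaceComplex) (p : pnt C) (w : seq (seg C)) :
    Prop :=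
  exists2 l : loop p, val l = w & loop_class l = 1.

Record lineCovering (L M : lineComplex) := LineCovering {
  cpnt : pnt L -> pnt M;
  cseg : seg L -> seg M;
  cpnt_surj : forall q, exists p, cpnt p = q;
  cseg_ini : forall s, ini (cseg s) = cpnt (ini s);
  cseg_opp : forall s, cseg (opp s) = opp (cseg s);
  cseg_star : forall p t, ini t = cpnt p ->
    exists! s, ini s = p /\ cseg s = t
}.

(* In cface_bdry the paths in ws are the factors w_1, ..., w_k of r. *)
Record covering (C D : surfaceComplex) := Covering {
  cline :> lineCovering C D;
  cface : face C -> face D;
  cface_opp : forall f, cface (fopp f) = fopp (cface f);
  cface_bdry : forall f p r, bdry f p r ->
    exists (r' : seq (seg D)) (ws : seq (seq (seg C))),
      [/\ bdry (cface f) (cpnt cline p) r', (0 < size ws)%N, r = flatten ws,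
          (forall w, w \in ws -> map (cseg cline) w = r') & uniq ws];
  cface_lift : forall g q r, bdry g q r ->
    forall p w p', cpnt cline p = q -> joins p w p' -> map (cseg cline) w = r ->
    exists! f, cface f = g /\ exists v, bdry f p (w ++ v)
}.

(* In cface_bdry the image of r is the size ws-th power of r', so this says that
   size ws = 1 for every surface piece. *)
Definition unbranched (C D : surfaceComplex) (A : covering C D) : Prop :=
  forall f p r, bdry f p r -> bdry (cface A f) (cpnt A p) (map (cseg A) r).

Definition regular (L M : lineComplex) (A : lineCovering L M) : Prop :=
  forall p w p' w' q', joins p w p -> joins p' w' q' ->
    map (cseg A) w = map (cseg A) w' -> p' = q'.

Definition simply_bounding (C : surfaceComplex) : Prop :=
  forall (f g : face C) p r, bdry f p r -> bdry g p r -> f = g.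

Definition one_point (L : lineComplex) : Prop := exists p : pnt L, forall q, q = p.

Definition universal (K C : surfaceComplex) (A' : covering K C) : Prop :=
  [/\ connected K, unbranched A' &
      forall p w q, joins p w q ->
        (p = q <-> nullhomotopic (cpnt A' p) (map (cseg A') w))].

Section CoveringLemmas.
Variables (L M : lineComplex) (A : lineCovering L M).

Lemma cseg_fin s : fin (cseg A s) = cpnt A (fin s).
Proof. by rewrite -ini_opp -cseg_opp cseg_ini ini_opp. Qed.

Lemma joins_map p w q :
  joins p w q -> joins (cpnt A p) (map (cseg A) w) (cpnt A q).
Proof.
elim: w p => [|s w IH] p /=; first by move/eqP->.
by case/andP=> /eqP <- /IH; rewrite cseg_ini cseg_fin eqxx.
Qed.

Lemma lift_path p t q :
  joins (cpnt A p) t q ->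
  exists w x, [/\ joins p w x, map (cseg A) w = t & cpnt A x = q].
Proof.
elim: t p => [|a t IH] p /=; first by move/eqP<-; exists [::], p; rewrite /= eqxx.
case/andP=> /eqP ia h; have [s [[si sa] _]] := cseg_star ia.
move: h; rewrite -sa cseg_fin => /IH[w [x [h1 h2 h3]]].
by exists (s :: w), x; rewrite /= si eqxx h2.
Qed.

Lemma lift_uniq p w w' x x' :
  joins p w x -> joins p w' x' -> map (cseg A) w = map (cseg A) w' -> w = w'.
Proof.
elim: w p w' => [|s w IH] p [|s' w'] //=.
case/andP=> /eqP si h /andP[/eqP s'i h'] [ss' ww'].
have [s0 [_ u]] := cseg_star (etrans (cseg_ini A s) (congr1 (cpnt A) si)).
have e : s = s' by rewrite -(u s) // -(u s').
by rewrite -e in h' *; rewrite (IH _ _ h h' ww').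
Qed.

End CoveringLemmas.

Section Composition.
Variables (L M N : lineComplex) (B : lineCovering M N) (A : lineCovering L M).

Fact comp_surj q : exists p, cpnt B (cpnt A p) = q.
Proof. by have [m <-] := cpnt_surj B q; have [p <-] := cpnt_surj A m; exists p. Qed.

Fact comp_ini s : ini (cseg B (cseg A s)) = cpnt B (cpnt A (ini s)).
Proof. by rewrite !cseg_ini. Qed.

Fact comp_opp s : cseg B (cseg A (opp s)) = opp (cseg B (cseg A s)).
Proof. by rewrite !cseg_opp. Qed.

Fact comp_star p t : ini t = cpnt B (cpnt A p) ->
  exists! s, ini s = p /\ cseg B (cseg A s) = t.
Proof.
move=> /cseg_star[m [[mi mt] um]]; have [s [[si sm] us]] := cseg_star mi.
exists s; split=> [|s' [s'i s't]]; first by rewrite sm.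
by apply: us; split=> //; rewrite (um (cseg A s')) // cseg_ini s'i.
Qed.

Definition comp_covering : lineCovering L N :=
  @LineCovering L N (fun p => cpnt B (cpnt A p)) (fun s => cseg B (cseg A s))
    comp_surj comp_ini comp_opp comp_star.

End Composition.

Section DeckGroup.
Variables (C D : surfaceComplex) (A : covering C D).

(* An automorphism of the line segment complex of C, given by its actions on
   points and on segments, that lies over the identity and extends to the
   surface pieces. *)
Record is_deck (h : (pnt C -> pnt C) * (seg C -> seg C)) : Prop := IsDeck {
  deck_pnt_bij : bijective h.1;
  deck_seg_bij : bijective h.2;
  deck_ini : forall s, ini (h.2 s) = h.1 (ini s);
  deck_opp : forall s, h.2 (opp s) = opp (h.2 s);
  deck_pnt_over : forall p, cpnt A (h.1 p) = cpnt A p;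
  deck_seg_over : forall s, cseg A (h.2 s) = cseg A s;
  deck_extends : exists phi : face C -> face C,
    [/\ bijective phi, forall f, phi (fopp f) = fopp (phi f),
        forall f, cface A (phi f) = cface A f &
        forall f p r, bdry f p r <-> bdry (phi f) (h.1 p) (map h.2 r)]
}.

Definition deck := {h : (pnt C -> pnt C) * (seg C -> seg C) | `[< is_deck h >]}.
HB.instance Definition _ := SubChoice.on deck.

Lemma deckP (h : deck) : is_deck (val h).
Proof. exact/asboolP/(valP h). Qed.

Fact deck1_subproof : `[< is_deck (id, id) >].
Proof.
apply/asboolP; split=> //=; try by exists id.
by exists id; split=> //; [exists id | move=> f p r; rewrite map_id].
Qed.
Definition deck1 : deck := exist (fun h => `[< is_deck h >]) _ deck1_subproof.

Fact deckM_subproof (h k : deck) :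
  `[< is_deck ((val h).1 \o (val k).1, (val h).2 \o (val k).2) >].
Proof.
apply/asboolP.
case: (deckP h) => h1 h2 h3 h4 h5 h6 [a [a1 a2 a3 a4]].
case: (deckP k) => k1 k2 k3 k4 k5 k6 [b [b1 b2 b3 b4]].
split=> /=; try exact: bij_comp.
- by move=> s; rewrite h3 k3.
- by move=> s; rewrite k4 h4.
- by move=> p; rewrite h5 k5.
- by move=> s; rewrite h6 k6.
exists (a \o b); split=> /= [|f|f|f p r]; first exact: bij_comp.
- by rewrite b2 a2.
- by rewrite a3 b3.
- by rewrite map_comp; apply: iff_trans (b4 _ _ _) (a4 _ _ _).
Qed.
Definition deckM (h k : deck) : deck :=
  exist (fun h => `[< is_deck h >]) _ (deckM_subproof h k).

Fact deckV_ex (h : deck) : exists k : deck,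
  [/\ cancel (val h).1 (val k).1, cancel (val k).1 (val h).1,
      cancel (val h).2 (val k).2 & cancel (val k).2 (val h).2].
Proof.
case: (deckP h) => [[g1 hg1 gh1] [g2 hg2 gh2] h3 h4 h5 h6].
case=> a [[b ab ba] a2 a3 a4].
suff d : `[< is_deck (g1, g2) >] by exists (exist (fun h => `[< is_deck h >]) _ d).
apply/asboolP; split=> /=.
- by exists (val h).1.
- by exists (val h).2.
- by move=> s; apply: (can_inj hg1); rewrite gh1 -h3 gh2.
- by move=> s; apply: (can_inj hg2); rewrite gh2 h4 gh2.
- by move=> p; rewrite -h5 gh1.
- by move=> s; rewrite -h6 gh2.
exists b; split=> [|f|f|f p r]; first by exists a.
- by apply: (can_inj ab); rewrite ba a2 ba.
- by rewrite -a3 ba.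
- apply: iff_sym; have := a4 (b f) (g1 p) (map g2 r).
  by rewrite ba gh1 (mapK gh2).
Qed.
Definition deckV (h : deck) : deck := projT1 (cid (deckV_ex h)).

Lemma deck_eq (h k : deck) :
  (val h).1 =1 (val k).1 -> (val h).2 =1 (val k).2 -> h = k.
Proof.
move=> /funext e1 /funext e2; apply: val_inj; move: e1 e2.
by case: (val h) => ? ?; case: (val k) => ? ? /= -> ->.
Qed.

Fact deck_mulA : associative deckM.
Proof. by move=> x y z; apply: deck_eq. Qed.
Fact deck_mul1 : left_id deck1 deckM.
Proof. by move=> x; apply: deck_eq. Qed.
Fact deck_mulr1 : right_id deck1 deckM.
Proof. by move=> x; apply: deck_eq. Qed.
Fact deck_mulV : left_inverse deck1 deckV deckM.
Proof.
by move=> x; rewrite /deckV; case: cid => y [? ? ? ?] /=; apply: deck_eq.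
Qed.
Fact deck_mulrV : right_inverse deck1 deckV deckM.
Proof.
by move=> x; rewrite /deckV; case: cid => y [? ? ? ?] /=; apply: deck_eq.
Qed.

HB.instance Definition _ := isGroup.Build deck
  deck_mulA deck_mul1 deck_mulr1 deck_mulV deck_mulrV.

Definition deckGroup : groupType := deck.

End DeckGroup.

Section Spelling.
Variables (M : lineComplex) (I : countType) (s : I -> seg M).

Definition spell_letter (x : letter I) : seg M :=
  if x.2 then s x.1 else opp (s x.1).

Definition spell (W : word I) : seq (seg M) := map spell_letter W.

(* M has the segments s_i and opp s_i, all distinct. *)
Definition orientation : Prop := forall t, exists! x, spell_letter x = t.

Lemma spell_cat U V : spell (U ++ V) = spell U ++ spell V.
Proof. exact: map_cat. Qed.

Lemma spell_inv W : spell (word_inv W) = path_inv (spell W).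
Proof.
rewrite /spell /word_inv /path_inv map_rev -!map_comp; congr rev.
by apply: eq_map => -[i []]; rewrite /spell_letter /= ?oppK.
Qed.

End Spelling.

Section PrincipalGroup.
Variables (K M : lineComplex) (B : lineCovering K M).
Variables (I : countType) (s : I -> seg M).

Definition closed_over (W : word I) : Prop :=
  forall p w q, joins p w q -> map (cseg B) w = spell s W -> p = q.

Definition relator : {pred freeGroup I} :=
  fun g => `[< exists2 W, g = word_class W & closed_over W >].

Lemma closed_over1 : closed_over [::].
Proof. by move=> p [|//] q /= /eqP. Qed.

Lemma closed_overM U V :
  closed_over U -> closed_over V -> closed_over (U ++ V).
Proof.
move=> hU hV p w q h; rewrite spell_cat => e.
move: h; rewrite -(cat_take_drop (size (spell s U)) w).
case/joins_cat=> x /hU pU /hV qV; rewrite pU ?qV //.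
- by rewrite map_drop e drop_size_cat.
- by rewrite map_take e take_size_cat.
Qed.

Lemma map_path_inv w : map (cseg B) (path_inv w) = path_inv (map (cseg B) w).
Proof.
rewrite /path_inv map_rev -!map_comp; congr rev.
by apply: eq_map => t /=; rewrite cseg_opp.
Qed.

Lemma closed_overV W : closed_over W -> closed_over (word_inv W).
Proof.
move=> hW p w q /joins_inv h; rewrite spell_inv => e.
by apply/esym/(hW _ _ _ h); rewrite map_path_inv e path_invK.
Qed.

Lemma closed_overJ W U : closed_over W -> closed_over (word_inv U ++ W ++ U).
Proof.
move=> hW p w q h; rewrite !spell_cat => e.
move: h; rewrite -(cat_take_drop (size (spell s (word_inv U))) w).
set w1 := take _ w; set w2 := drop _ w.
have e1 : map (cseg B) w1 = spell s (word_inv U).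
  by rewrite map_take e take_size_cat.
have : map (cseg B) w2 = spell s W ++ spell s U.
  by rewrite map_drop e drop_size_cat.
rewrite -(cat_take_drop (size (spell s W)) w2).
set w3 := take _ w2; set w4 := drop _ w2 => e2.
have sz : (size (spell s W) <= size w2)%N.
  by rewrite -(size_map (cseg B)) -(cat_take_drop (size (spell s W)) w2) e2
             size_cat leq_addr.
have s3 : size (map (cseg B) w3) = size (spell s W).
  by rewrite size_map size_takel.
move: e2; rewrite map_cat => /eqP; rewrite eqseq_cat // => /andP[/eqP e3 /eqP e4].
case/joins_cat=> x h1 /joins_cat[y h3 h4].
have xy := hW _ _ _ h3 e3; rewrite -xy in h4.
have e5 : path_inv w1 = w4.
  apply: (@lift_uniq _ _ B x _ _ p q) => //; first exact: joins_inv.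
  by rewrite map_path_inv e1 e4 spell_inv path_invK.
by rewrite -e5 in h4; apply: joins_fun (joins_inv h1) h4.
Qed.

Fact relator1 : 1 \in relator.
Proof. by apply/asboolP; exists [::] => //; apply: closed_over1. Qed.

Fact relatorM : mulg_closed relator.
Proof.
move=> _ _ /asboolP[U -> hU] /asboolP[V -> hV]; apply/asboolP.
by exists (U ++ V); rewrite ?word_classM //; apply: closed_overM.
Qed.

Fact relatorV : invg_closed relator.
Proof.
move=> _ /asboolP[U -> hU]; apply/asboolP.
by exists (word_inv U); rewrite ?word_classV //; apply: closed_overV.
Qed.

Definition relators : groupClosed (freeGroup I) :=
  HB.pack relator (isMul1Closed.Build (freeGroup I) relator relator1)
    (isMulClosed.Build (freeGroup I) relator relatorM)
    (isInvClosed.Build (freeGroup I) relator relatorV).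

Fact relators_normal : normal relators.
Proof.
move=> _ y /asboolP[W -> hW]; have [U ->] := classW y; apply/asboolP.
exists (word_inv U ++ W ++ U); last exact: closed_overJ.
by rewrite !word_classM word_classV.
Qed.

Definition principalGroup : groupType := factorGroup relators_normal.

Definition principal_class (W : word I) : principalGroup :=
  @class (coset_pre relators_normal) (word_class W).

Lemma principal_classM U V :
  principal_class (U ++ V) = principal_class U * principal_class V.
Proof. by rewrite /principal_class word_classM; apply: (@classM (coset_pre _)). Qed.

Lemma principal_class1 : principal_class [::] = 1.
Proof. by []. Qed.

Lemma principal_classV W : principal_class (word_inv W) = (principal_class W)^-1.
Proof. by rewrite /principal_class word_classV; apply: (@classV (coset_pre _)). Qed.

End PrincipalGroup.

Section PathSubgroup.
Variables (K C M : lineComplex) (A : lineCovering C M) (A' : lineCovering K C).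
Variables (I : countType) (s : I -> seg M) (p0 : pnt C).

Local Notation V := (principalGroup (comp_covering A A') s).

Definition path_element : {pred V} :=
  fun v => `[< exists p w q W,
    [/\ joins p w q, cpnt A' p = p0, cpnt A' q = p0,
        map (cseg (comp_covering A A')) w = spell s W &
        v = principal_class (comp_covering A A') s W] >].

Fact path_element1 : 1 \in path_element.
Proof.
have [p hp] := cpnt_surj A' p0; apply/asboolP; exists p, [::], p, [::].
by split=> //=.
Qed.

Fact path_elementM : mulg_closed path_element.
Proof.
move=> u v /asboolP[p [w [q [U [h hp hq e ->]]]]].
case/asboolP=> p' [w' [q' [W [h' hp' hq' e' ->]]]]; apply/asboolP.
have h2 := joins_map A' h'; rewrite hp' -hq in h2.
have [w2 [x [hw2 ew2 hx]]] := lift_path h2.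
exists p, (w ++ w2), x, (U ++ W); split=> //.
- by apply/joins_cat; exists q.
- by rewrite hx.
- rewrite map_cat spell_cat e -e'; congr cat.
  by rewrite (map_comp (cseg A) (cseg A')) ew2 -map_comp.
- by rewrite principal_classM.
Qed.

Fact path_elementV : invg_closed path_element.
Proof.
move=> _ /asboolP[p [w [q [U [h hp hq e ->]]]]]; apply/asboolP.
exists q, (path_inv w), p, (word_inv U); split=> //; first exact: joins_inv.
- by rewrite map_path_inv e spell_inv.
- by rewrite principal_classV.
Qed.

Definition pathSubgroup : groupClosed V :=
  HB.pack path_element (isMul1Closed.Build V path_element path_element1)
    (isMulClosed.Build V path_element path_elementM)
    (isInvClosed.Build V path_element path_elementV).

End PathSubgroup.

(* Main.v *)
Require Import Defs.
From HB Require Import structures.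
From Stdlib Require Import Relations.
From mathcomp Require Import all_boot.
From mathcomp Require Import boolp.

Set Implicit Arguments.
Unset Strict Implicit.
Unset Printing Implicit Defensive.

(** Since the base complex has a single point, every word in its segments is a
    closed path there and lifts, from each point of a covering complex, to
    exactly one path; sending the initial point to the final point makes words
    act from the right on the points of C and of K ([moves]), compatibly with
    the covering of C by K.  Words of the same class in the principal group act
    alike on K, hence on C, so the principal group V acts on the points of C.

    Regularity of the covering makes the group T of deck transformations
    simply transitive on the points of C.  To carry p to q, join p to x by a
    path and follow the path over the same base path from q; its end does not
    depend on the choice, by regularity ([corresponds_fun]).  That this map
    extends to the surface pieces is the only place where branching matters:
    the number of times that a simple boundary path winds around the boundary
    of the piece below it is the least number after which the lift closes up,
    and by regularity this number is the same at all points
    ([branching_order_le], [face_transport]).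

    Regularity also says that a word fixing one point of C fixes all of them.
    The subgroup U is the stabiliser of p0 ([pathSubgroupP]), so it is
    the kernel of the action and is normal.  For a class v in V, let h_v be the deck
    transformation with h_v(p0) = p0 . v.  Deck transformations commute with the
    action of words, so h_(vw)(p0) = h_v(p0) . w = h_v(p0 . w) = h_v(h_w(p0)),
    and v |-> h_v induces the isomorphism of V / U with T
    ([deck_isomorphic]).

    Finally U consists of the words that are spelled by loops of C at p0.  A
    loop there is nullhomotopic if and only if all paths of K over its word are
    closed ([closed_over_loop]): those over p0 by the characterisation of the
    universal covering, and those over any other point because a deck
    transformation carries the loop, with its nullhomotopy, to that point.
    Hence a loop and its word determine each other's classes
    ([principal_class_loop]), which is the isomorphism of U with the
    fundamental group ([subgroup_isomorphic]). *)

(** * Preliminaries *)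

(** Groups of classes carry no convenient maps out of them; giving an
    isomorphism as a relation between representatives avoids choosing them. *)
Lemma isomorphic_of_rel (G H : groupType) (R : G -> H -> Prop) :
  (forall x, exists y, R x y) -> (forall y, exists x, R x y) ->
  (forall x y y', R x y -> R x y' -> y = y') ->
  (forall x x' y, R x y -> R x' y -> x = x') ->
  (forall x y x' y', R x y -> R x' y' -> R (x * x')%g (y * y')%g) ->
  isomorphic G H.
Proof.
move=> /choice[f fP] /choice[g gP] funR injR mulR.
have fM : {morph f : x y / (x * y)%g >-> (x * y)%g}.
  by move=> x y; apply: (funR (x * y)%g) (fP _) (mulR _ _ _ _ (fP x) (fP y)).
pose F : {multiplicative G -> H} := HB.pack f (isMultiplicative.Build G H f fM).
exists F; exists g => [x|y]; first exact: injR (gP _) (fP _).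
exact: funR (fP _) (gP _).
Qed.

Lemma loop_class_eq1 (C : surfaceComplex) (p : pnt C) (l : loop p) :
  loop_class l = 1%g <-> homotopic p (val l) [::].
Proof. exact: (@classP (loop_pre p) l (loop1 p)). Qed.

Lemma nullhomotopicE (C : surfaceComplex) (p : pnt C) w :
  nullhomotopic p w <-> joins p w p /\ homotopic p w [::].
Proof.
split=> [[l <- /loop_class_eq1 h]|[h e]]; first by split; first exact: (valP l).
by exists (exist (fun w => joins p w p) w h) => //; apply/loop_class_eq1.
Qed.

Lemma one_point_eq (L : lineComplex) (p q : pnt L) : one_point L -> p = q.
Proof. by case=> o oP; rewrite (oP p) (oP q). Qed.

Lemma joins_one_point (L : lineComplex) (p q : pnt L) w :
  one_point L -> joins p w q.
Proof.
move=> L1; elim: w p => [|s w IH] p /=; first exact/eqP/one_point_eq.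
by rewrite IH andbT; apply/eqP/one_point_eq.
Qed.

(** * The action of words on the points of a covering complex *)

Section Moves.
Variables (K M : lineComplex) (B : lineCovering K M) (I : countType).
Variables (s : I -> seg M) (M1 : one_point M).
Implicit Types (p q x : pnt K) (U V W : word I).

Definition moves p W q := exists2 w, joins p w q & map (cseg B) w = spell s W.

Lemma moves_ex p W : exists q, moves p W q.
Proof.
have [w [q [h e _]]] :=
  lift_path (joins_one_point (cpnt B p) (cpnt B p) (spell s W) M1).
by exists q, w.
Qed.

Lemma moves_fun p W q q' : moves p W q -> moves p W q' -> q = q'.
Proof.
move=> [w h e] [w' h' e']; rewrite -e' in e.
have ww' := lift_uniq h h' e; rewrite -ww' in h'.
exact: joins_fun h h'.
Qed.

Lemma moves_cat p U V q :
  moves p (U ++ V) q <-> exists2 x, moves p U x & moves x V q.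
Proof.
split=> [[w h e]|[x [u hu eu] [v hv ev]]]; last first.
  by exists (u ++ v); [apply/joins_cat; exists x | rewrite map_cat spell_cat eu ev].
move: h; rewrite -(cat_take_drop (size (spell s U)) w) => /joins_cat[x hu hv].
exists x.
  by eexists; first exact: hu; rewrite map_take e spell_cat take_size_cat.
by eexists; first exact: hv; rewrite map_drop e spell_cat drop_size_cat.
Qed.

Lemma moves_inv p W q : moves p W q -> moves q (word_inv W) p.
Proof.
move=> [w h e]; exists (path_inv w); first exact: joins_inv.
by rewrite map_path_inv e spell_inv.
Qed.

(** A letter followed by its inverse leads along a segment and back, so freely
    equal words act in the same way. *)
Lemma moves_word_eq U V : word_eq U V -> forall p q, moves p U q <-> moves p V q.
Proof.
elim=> [_ _ [a b x]|W|U' V' _ IH|a b c _ IH1 _ IH2] p q; last 3 first.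
- by [].
- exact: iff_sym.
- exact: iff_trans (IH1 _ _) (IH2 _ _).
have spur y z : moves y [:: x; letter_inv x] z <-> y = z.
  have [t yt] := moves_ex y [:: x].
  have yy : moves y [:: x; letter_inv x] y.
    by apply/(moves_cat y [:: x]); exists t => //; apply: (moves_inv yt).
  by split=> [yz|<- //]; apply: moves_fun yy yz.
rewrite -[x :: _]/([:: x; letter_inv x] ++ b).
split=> /moves_cat[y ay yb]; apply/moves_cat; exists y => //.
  by apply/moves_cat; exists y => //; apply/spur.
by case/moves_cat: yb => z /spur ->.
Qed.

Lemma closed_overE W : closed_over B s W <-> forall p q, moves p W q -> p = q.
Proof.
split=> [h p q [w]|h p w q hw e]; first exact: h.
by apply: h; exists w.
Qed.

(** Membership among the relators asks for some freely equal word with closed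
    lifts; as freely equal words act alike, the word at hand will do. *)
Lemma principal_class_eq U V :
  principal_class B s U = principal_class B s V <->
  closed_over B s (word_inv U ++ V).
Proof.
have cosetE : principal_class B s U = principal_class B s V <->
    ((word_class U)^-1 * word_class V)%g \in relators B s.
  exact: (@classP (coset_pre (@relators_normal _ _ B _ s))).
apply: (iff_trans cosetE); rewrite -word_classV -word_classM.
split=> [/asboolP[W /(classP (P := free_pre I)) /= e hW]|h]; last first.
  by apply/asboolP; eexists; first by reflexivity.
apply/closed_overE => p q /(moves_word_eq e); move/closed_overE: hW; exact.
Qed.

(** The principal group acts on the points of the covering complex. *)
Lemma principal_class_moves U V p q :
  principal_class B s U = principal_class B s V -> moves p U q -> moves p V q.
Proof.
move=> /principal_class_eq/closed_overE h pU.
have [x pV] := moves_ex p V.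
by rewrite (h q x) //; apply/moves_cat; exists p => //; apply: moves_inv.
Qed.

Lemma principal_classW (v : principalGroup B s) :
  exists W, v = principal_class B s W.
Proof.
have [g ->] := classW v; have [W ->] := classW g.
by exists W.
Qed.

End Moves.

Lemma spell_onto (M : lineComplex) (I : countType) (s : I -> seg M) t :
  orientation s -> exists W, spell s W = t.
Proof.
move=> so; elim: t => [|a t [W <-]]; first by exists [::].
by have [x [<- _]] := so a; exists (x :: W).
Qed.

(** * Surface pieces of a regular covering *)

Lemma map_flatten_const (T : eqType) (S : eqType) (g : T -> S) (ws : seq (seq T)) b :
  (forall w, w \in ws -> map g w = b) ->
  map g (flatten ws) = flatten (nseq (size ws) b).
Proof.
elim: ws => //= w ws IH h; rewrite map_cat h ?mem_head // IH // => u uws.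
by rewrite h // in_cons uws orbT.
Qed.

Section RegularCovering.
Variables (C D : surfaceComplex) (A : covering C D).
Variables (D1 : one_point D) (A_regular : regular A).
Implicit Types (p q x y : pnt C) (r t : seq (seg C)) (f : face C).

(** If the lift of b^n closes up at p, it closes up at p' by regularity.  Were
    there more than n factors at p', the factor after the n-th one would start
    at p' again and be equal to the first one. *)
Lemma branching_order_le p ws p' ws' q' b :
  (0 < size ws)%N -> joins p (flatten ws) p -> joins p' (flatten ws') q' ->
  (forall w, w \in ws -> map (cseg A) w = b) ->
  (forall w, w \in ws' -> map (cseg A) w = b) -> uniq ws' ->
  (size ws' <= size ws)%N.
Proof.
move=> n_gt0 h h' e e'; rewrite leqNgt => uws'; apply/negP => lt_n.
move: uws'; rewrite -(cat_take_drop (size ws) ws') cat_uniq.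
case/and3P=> _ /negP nh _; apply: nh; apply/hasP.
set u := take _ _; set v := drop _ _.
have su : size u = size ws by rewrite size_takel // ltnW.
have sv : (0 < size v)%N by rewrite size_drop subn_gt0.
have mu w : w \in u -> w \in ws' by apply: mem_take.
have mv w : w \in v -> w \in ws' by apply: mem_drop.
have : joins p' (flatten u ++ flatten v) q' by rewrite -flatten_cat cat_take_drop.
case/joins_cat => z hu.
(* u covers the same base path as the closed path flatten ws. *)
have <- : p' = z.
  apply: (A_regular h hu); rewrite (map_flatten_const e).
  by rewrite (@map_flatten_const _ _ _ u b) ?su // => w /mu /e'.
case: u su mu hu n_gt0 => [|a u] /= => [<- //|_ mu + _].
case: v sv mv => [//|c v] /= _ mv /joins_cat[x ha _] /joins_cat[y hc _].
exists c; first exact: mem_head.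
have -> : c = a.
  by apply: (lift_uniq (A := A) hc ha); rewrite !e' //;
    [apply: mu | apply: mv]; apply: mem_head.
exact: mem_head.
Qed.

(** The factor of r' over the boundary b of the base piece is the beginning of
    the boundary path of some piece over the same base piece.  That path is a
    lift of a power of b, and comparing the exponents in both directions shows
    that the lift is r' itself. *)
Lemma face_transport f p r p' r' q' :
  bdry f p r -> joins p' r' q' -> map (cseg A) r' = map (cseg A) r ->
  exists2 f', cface A f' = cface A f & bdry f' p' r'.
Proof.
move=> fpr hr' er; have hr := bdry_closed fpr.
have [b [ws [gb ws0 er_ws ws_b uws]]] := cface_bdry A fpr.
have r'b : map (cseg A) r' = flatten (nseq (size ws) b).
  by rewrite er er_ws (map_flatten_const ws_b).
have : joins p' (take (size b) r' ++ drop (size b) r') q'.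
  by rewrite cat_take_drop.
case/joins_cat=> x; set w1 := take _ _ => hw1 _.
have w1b : map (cseg A) w1 = b.
  by rewrite map_take r'b; case: (size ws) ws0 => //= n _; rewrite take_size_cat.
have [f' [[gf' [v f'v]] _]] := cface_lift gb (one_point_eq _ _ D1) hw1 w1b.
exists f' => //; suff <- : w1 ++ v = r' by [].
have [b' [ws' [gb' ws'0 er'' ws'_b' uws']]] := cface_bdry A f'v.
(* A cyclic interchange of b covered by a path that begins with w1 is b. *)
have b'b : b' = b.
  have sb : size b' = size b.
    move: gb'; rewrite gf' => /(bdry_cyclic gb)[u [u' [-> -> _]]].
    by rewrite !size_cat addnC.
  case: ws' ws'0 er'' ws'_b' {uws'} => //= a ws' _ e ws'_b'.
  have ab := ws'_b' a (mem_head _ _).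
  have sa : size w1 = size a.
    by rewrite -(size_map (cseg A) a) ab sb -w1b size_map.
  have := congr1 (take (size a)) e; rewrite take_size_cat // -?sa // => w1a.
  by rewrite -ab -w1b w1a sa take_size_cat.
rewrite {}b'b in gb' ws'_b'.
have hf' := bdry_closed f'v.
apply: (lift_uniq (A := A) hf' hr'); rewrite r'b er'' (map_flatten_const ws'_b').
congr (flatten (nseq _ _)); apply/eqP; rewrite eqn_leq.
rewrite er_ws in hr; rewrite er'' in hf'.
by rewrite (branching_order_le ws0 hr hf' ws_b ws'_b' uws')
  (branching_order_le ws'0 hf' hr ws'_b' ws_b uws).
Qed.

Lemma face_over_uniq f f' p r :
  cface A f = cface A f' -> bdry f p r -> bdry f' p r -> f = f'.
Proof.
move=> ff' fr f'r; have [b [ws [gb ws0 er_ws ws_b _]]] := cface_bdry A fr.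
case: ws ws0 er_ws ws_b => // a ws _ /= er ws_b.
have := bdry_closed fr; rewrite er => /joins_cat[x ha _].
have [f0 [_ u]] := cface_lift gb erefl ha (ws_b a (mem_head _ _)).
by rewrite -(u f) ?(u f') //; split=> //; exists (flatten ws); rewrite -er.
Qed.

(** The conditions of [is_deck] on segments; for a regular covering of a
    one-point complex and an invertible h whose inverse satisfies them too, they
    imply the others ([is_deck_over]). *)
Record over_base (h : (pnt C -> pnt C) * (seg C -> seg C)) : Prop := OverBase {
  over_ini : forall s, ini (h.2 s) = h.1 (ini s);
  over_opp : forall s, h.2 (opp s) = opp (h.2 s);
  over_seg : forall s, cseg A (h.2 s) = cseg A s
}.

Lemma over_fin h s : over_base h -> fin (h.2 s) = h.1 (fin s).
Proof. by move=> oh; rewrite -ini_opp -(over_opp oh) (over_ini oh) ini_opp. Qed.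

Lemma joins_over h p w q :
  over_base h -> joins p w q -> joins (h.1 p) (map h.2 w) (h.1 q).
Proof.
move=> oh; elim: w p => [|s w IH] p /=; first by move/eqP->.
by case/andP=> /eqP <- /IH; rewrite (over_ini oh) (over_fin _ oh) eqxx.
Qed.

Lemma map_over h w : over_base h -> map (cseg A) (map h.2 w) = map (cseg A) w.
Proof. by move=> oh; rewrite -map_comp; apply: eq_map => s /=; rewrite over_seg. Qed.

(** One boundary path of f suffices to find f'; the others are its cyclic
    interchanges. *)
Lemma face_over h f : over_base h ->
  exists f', cface A f' = cface A f /\
    forall p r, bdry f p r -> bdry f' (h.1 p) (map h.2 r).
Proof.
move=> oh; have [q [t fqt]] := bdry_ex f.
have [f' gf' f'qt] :=
  face_transport fqt (joins_over oh (bdry_closed fqt)) (map_over t oh).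
exists f'; split=> // p r /(bdry_cyclic fqt)[u [v [et -> hu]]].
apply/(bdry_cyclic f'qt); exists (map h.2 u), (map h.2 v).
by rewrite et !map_cat; split=> //; apply: joins_over.
Qed.

(** The two maps of surface pieces induced by h and by k are inverse to each
    other because a piece is determined by its image and a boundary path. *)
Lemma is_deck_over h k : over_base h -> over_base k ->
  cancel h.1 k.1 -> cancel k.1 h.1 -> cancel h.2 k.2 -> cancel k.2 h.2 ->
  is_deck A h.
Proof.
move=> oh ok hk1 kh1 hk2 kh2.
have [phi phiP] := choice (fun f => @face_over h f oh).
have [psi psiP] := choice (fun f => @face_over k f ok).
have phiK : cancel phi psi.
  move=> f; have [p [r fpr]] := bdry_ex f; apply: (@face_over_uniq _ _ p r) => //.
    by rewrite (proj1 (psiP _)) (proj1 (phiP _)).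
  have := proj2 (psiP _) _ _ (proj2 (phiP _) _ _ fpr).
  by rewrite hk1 mapK.
have psiK : cancel psi phi.
  move=> f; have [p [r fpr]] := bdry_ex f; apply: (@face_over_uniq _ _ p r) => //.
    by rewrite (proj1 (phiP _)) (proj1 (psiP _)).
  have := proj2 (phiP _) _ _ (proj2 (psiP _) _ _ fpr).
  by rewrite kh1 mapK.
split; [by exists k.1 | by exists k.2 | exact: over_ini oh | exact: over_opp oh |
        | exact: over_seg oh |].
  by move=> p; apply: one_point_eq.
exists phi; split=> [|f|f|f p r].
- by exists psi.
- have [p [r fpr]] := bdry_ex f; have hf := proj2 (phiP _) _ _ fpr.
  apply: (@face_over_uniq _ _ (h.1 p) (map h.2 (path_inv r))).
  + by rewrite cface_opp !(proj1 (phiP _)) cface_opp.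
  + by apply: (proj2 (phiP _)); apply: bdry_opp.
  + have -> : map h.2 (path_inv r) = path_inv (map h.2 r).
      rewrite /path_inv map_rev -!map_comp; congr rev.
      by apply: eq_map => s /=; rewrite over_opp.
    exact: bdry_opp.
- exact: (proj1 (phiP _)).
split=> [|hf]; first exact: (proj2 (phiP _)).
by have := proj2 (psiP _) _ _ hf; rewrite phiK hk1 mapK.
Qed.

End RegularCovering.

(** * The deck group is simply transitive on points *)

Section DeckTransitive.
Variables (C D : surfaceComplex) (A : covering C D).
Variables (C_connected : connected C) (D1 : one_point D) (A_regular : regular A).
Implicit Types (p q x y : pnt C).

(** The graph of the deck transformation that carries p to q. *)
Definition corresponds p q x y := exists w w',
  [/\ joins p w x, joins q w' y & map (cseg A) w = map (cseg A) w'].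

Lemma correspondsC p q x y : corresponds p q x y -> corresponds q p y x.
Proof. by move=> [w [w' [h h' e]]]; exists w', w. Qed.

Lemma corresponds_ex p q x : exists y, corresponds p q x y.
Proof.
have [w h] := C_connected p x.
have [w' [y [h' e _]]] :=
  lift_path (joins_one_point (cpnt A q) (cpnt A q) (map (cseg A) w) D1).
by exists y, w, w'.
Qed.

(** Two paths from p to x form a closed path at x; by regularity the
    corresponding path from y to y' is closed as well. *)
Lemma corresponds_fun p q x y y' :
  corresponds p q x y -> corresponds p q x y' -> y = y'.
Proof.
move=> [u [u' [h h' e]]] [v [v' [k k' e']]].
apply: (A_regular (p := x) (w := path_inv u ++ v) (w' := path_inv u' ++ v')).
- by apply/joins_cat; exists p => //; apply: joins_inv.
- by apply/joins_cat; exists q => //; apply: joins_inv.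
- by rewrite !map_cat !map_path_inv e e'.
Qed.

Lemma translation_ex p q : exists h, over_base A h /\
  forall x, corresponds p q x (h.1 x).
Proof.
have [h1 h1P] := choice (corresponds_ex p q).
have h2_ex s : exists t, ini t = h1 (ini s) /\ cseg A t = cseg A s.
  have ia : ini (cseg A s) = cpnt A (h1 (ini s)) by exact: one_point_eq.
  by have [t [ht _]] := cseg_star ia; exists t.
have [h2 h2P] := choice h2_ex.
have h2_fin s : fin (h2 s) = h1 (fin s).
  have [i2 a2] := h2P s.
  apply: corresponds_fun (h1P _); have [w [w' [h h' e]]] := h1P (ini s).
  exists (rcons w s), (rcons w' (h2 s)); split; last by rewrite !map_rcons e a2.
  - by rewrite -cats1; apply/joins_cat; exists (ini s); rewrite //= !eqxx.
  - by rewrite -cats1; apply/joins_cat; exists (h1 (ini s)); rewrite //= i2 !eqxx.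
exists (h1, h2); split=> //; split=> /= s; try by case: (h2P s).
have ia : ini (cseg A (opp s)) = cpnt A (h1 (ini (opp s))).
  exact: one_point_eq.
have [t [_ u]] := cseg_star ia.
rewrite -(u (h2 (opp s))) // -(u (opp (h2 s))) //.
by rewrite !ini_opp !cseg_opp h2_fin (proj2 (h2P s)).
Qed.

Lemma over_base_seg_uniq h s t : over_base A h ->
  ini s = h.1 (ini t) -> cseg A s = cseg A t -> s = h.2 t.
Proof.
move=> oh i e; have ia : ini (cseg A t) = cpnt A (h.1 (ini t)).
  exact: one_point_eq.
have [t' [_ u]] := cseg_star ia.
by rewrite -(u s) // -(u (h.2 t)) // (over_ini oh) (over_seg oh).
Qed.

Lemma deck_transitive p q : exists h : deckGroup A, (val h).1 p = q.
Proof.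
have [h [oh hP]] := translation_ex p q; have [k [ok kP]] := translation_ex q p.
have hk : cancel h.1 k.1.
  by move=> x; apply: corresponds_fun (kP _) (correspondsC (hP x)).
have kh : cancel k.1 h.1.
  by move=> x; apply: corresponds_fun (hP _) (correspondsC (kP x)).
have dh : is_deck A h.
  apply: (is_deck_over D1 A_regular oh ok) => // s.
  - by apply/esym/(over_base_seg_uniq ok); rewrite ?(over_seg oh) // (over_ini oh) hk.
  - by apply/esym/(over_base_seg_uniq oh); rewrite ?(over_seg ok) // (over_ini ok) kh.
exists (exist (fun h => `[< is_deck A h >]) h (asboolT dh)) => /=.
by apply: corresponds_fun (hP p) _; exists [::], [::]; rewrite /= !eqxx.
Qed.

Lemma deck_over (h : deckGroup A) : over_base A (val h).
Proof. by case: (deckP h) => *; split. Qed.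

(** Both images of a path from p are lifts of the same base path from the same
    point. *)
Lemma deck_semiregular (h k : deckGroup A) p :
  (val h).1 p = (val k).1 p -> h = k.
Proof.
move=> hkp; have e1 : (val h).1 =1 (val k).1.
  move=> x; have [w px] := C_connected p x.
  have hx := joins_over (deck_over h) px; have kx := joins_over (deck_over k) px.
  rewrite -hkp in kx; suff e : map (val h).2 w = map (val k).2 w.
    by rewrite -e in kx; apply: joins_fun hx kx.
  by apply: (lift_uniq (A := A) hx kx); rewrite !(map_over _ (deck_over _)).
apply: deck_eq => // s; apply: (over_base_seg_uniq (deck_over k)).
  by rewrite (over_ini (deck_over h)) e1.
by rewrite (over_seg (deck_over h)).
Qed.

Lemma deck_homotopic (h : deckGroup A) p w w' :
  homotopic p w w' -> homotopic ((val h).1 p) (map (val h).2 w) (map (val h).2 w').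
Proof.
elim=> [_ _ [u v s hu|u v q f r hu fr]|?|? ? _|? t ? _ ? _ ?].
- rewrite !map_cat /= (deck_opp (deckP h)); apply/rst_step/SpurStep.
  by rewrite (deck_ini (deckP h)); apply: joins_over (deck_over h) hu.
- rewrite !map_cat; have [phi [_ _ _ phiP]] := deck_extends (deckP h).
  apply: rst_step.
  by apply: (FaceStep _ (joins_over (deck_over h) hu) ((phiP _ _ _).1 fr)).
- exact: rst_refl.
- exact: rst_sym.
- by apply: rst_trans; eassumption.
Qed.

End DeckTransitive.

(** * The principal group, the deck group and the fundamental group *)

Section RegularCoveringOfOnePoint.
Variables (C Cs : surfaceComplex) (A : covering C Cs) (p0 : pnt C).
Variables (C_connected : connected C) (Cs1 : one_point Cs) (A_regular : regular A).
Variables (K : surfaceComplex) (A' : covering K C) (A'_universal : universal A').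
Variables (I : countType) (s : I -> seg Cs) (s_orientation : orientation s).

Local Notation A'' := (comp_covering A A').
Local Notation V := (principalGroup A'' s).
Local Notation U := (pathSubgroup A A' s p0).
Local Notation pc := (principal_class A'' s).

Lemma moves_regular p W p' q' : moves A s p W p -> moves A s p' W q' -> p' = q'.
Proof. by move=> [w h e] [w' h' e']; apply: (A_regular h h'); rewrite e e'. Qed.

Lemma moves_deck (h : deckGroup A) p W q :
  moves A s p W q -> moves A s ((val h).1 p) W ((val h).1 q).
Proof.
move=> [w hw e]; exists (map (val h).2 w); first exact: joins_over (deck_over h) hw.
by rewrite (map_over _ (deck_over h)).
Qed.

Lemma moves_down p W q : moves A'' s p W q -> moves A s (cpnt A' p) W (cpnt A' q).
Proof.
by move=> [w h e]; exists (map (cseg A') w); [exact: joins_map | rewrite -map_comp].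
Qed.

Lemma moves_up p W q : moves A s (cpnt A' p) W q ->
  exists2 x, cpnt A' x = q & moves A'' s p W x.
Proof.
move=> [w h e]; have [u [x [hu eu ex]]] := lift_path h.
by exists x => //; exists u; rewrite // -e -eu -map_comp.
Qed.

(** The paths of K between points over p0 are the lifts of the loops of C
    at p0. *)
Lemma pathSubgroupP W : (pc W \in U) <-> moves A s p0 W p0.
Proof.
split=> [/asboolP[p [w [q [Z [h hp hq e eWZ]]]]]|].
  rewrite -{1}hp -hq; apply: moves_down.
  by apply: (principal_class_moves Cs1 (esym eWZ)); exists w.
have [p hp] := cpnt_surj A' p0; rewrite -{1}hp => /moves_up[q hq [w h e]].
by apply/asboolP; exists p, w, q, W.
Qed.

(** A word that fixes p0 fixes every point, in particular the point that an
    arbitrary word carries to p0. *)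
Lemma pathSubgroup_normal : normal U.
Proof.
move=> x y; have [Z ->] := principal_classW x; have [W ->] := principal_classW y.
have -> : (pc Z ^ pc W)%g = pc (word_inv W ++ Z ++ W).
  by rewrite !principal_classM principal_classV.
move=> /pathSubgroupP hZ; apply/pathSubgroupP.
have [x1 h1] := moves_ex A s Cs1 p0 (word_inv W).
apply/moves_cat; exists x1 => //; apply/moves_cat; exists x1.
  have [x2 h2] := moves_ex A s Cs1 x1 Z.
  by have e := moves_regular hZ h2; rewrite -e in h2.
by have := moves_inv h1; rewrite word_invK.
Qed.

Definition factor_class W : factorGroup pathSubgroup_normal :=
  @class (coset_pre pathSubgroup_normal) (pc W).

(** By regularity the action of V on the orbit of p0 is that of V / U on itself
    by right multiplication. *)
Lemma factor_class_eq W W' x x' :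
  moves A s p0 W x -> moves A s p0 W' x' ->
  factor_class W = factor_class W' <-> x = x'.
Proof.
move=> h h'; have classE : factor_class W = factor_class W' <->
    pc (word_inv W ++ W') \in U.
  rewrite principal_classM principal_classV.
  exact: (@classP (coset_pre pathSubgroup_normal)).
apply: (iff_trans classE); apply: (iff_trans (pathSubgroupP _)).
have xx' : moves A s x (word_inv W ++ W') x'.
  by apply/moves_cat; exists p0 => //; apply: moves_inv.
split=> [h0|e]; first exact: moves_regular h0 xx'.
rewrite -{}e in xx'; have [y hy] := moves_ex A s Cs1 p0 (word_inv W ++ W').
by have e := moves_regular xx' hy; rewrite -e in hy.
Qed.

(** A deck transformation h is matched with the words that carry p0 to h(p0). *)
Lemma deck_isomorphic : isomorphic (deckGroup A) (factorGroup pathSubgroup_normal).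
Proof.
apply: (@isomorphic_of_rel (deckGroup A) (factorGroup pathSubgroup_normal)
  (fun h z => exists2 W, moves A s p0 W ((val h).1 p0) & z = factor_class W))
  => [h|z|h z z'|h h' z|h z h' z'].
- have [w hw] := C_connected p0 ((val h).1 p0).
  have [W eW] := spell_onto (map (cseg A) w) s_orientation.
  by exists (factor_class W), W => //; exists w.
- have [v ->] := classW z; have [W ->] := principal_classW v.
  have [q hq] := moves_ex A s Cs1 p0 W.
  have [h eh] := deck_transitive C_connected Cs1 A_regular p0 q.
  by exists h, W; rewrite ?eh.
- by move=> [W hW ->] [W' hW' ->]; apply/(factor_class_eq hW hW').
- move=> [W hW ->] [W' hW' e].
  apply: (@deck_semiregular _ _ _ C_connected Cs1 _ _ p0).
  exact/(factor_class_eq hW hW').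
- move=> [W hW ->] [W' hW' ->]; exists (W ++ W').
    by apply/moves_cat; exists ((val h).1 p0) => //; apply: (moves_deck h).
  by rewrite /factor_class principal_classM; apply/esym/(@classM (coset_pre _)).
Qed.

(** The lifts of l to K close up exactly when l is nullhomotopic; the remaining
    paths of K over W lie above the images of l under deck transformations,
    which preserve homotopy. *)
Lemma closed_over_loop W (l : loop p0) :
  map (cseg A) (val l) = spell s W ->
  closed_over A'' s W <-> loop_class l = 1%g.
Proof.
have [_ _ univ] := A'_universal => el; split=> [hW|l1].
  have [p hp] := cpnt_surj A' p0.
  have hl : joins (cpnt A' p) (val l) p0 by rewrite hp; apply: (valP l).
  have [w [q [hw ew _]]] := lift_path hl.
  have pq : p = q by apply: (hW _ _ _ hw); rewrite -el -ew -map_comp.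
  have := (univ _ _ _ hw).1 pq; rewrite ew hp => /nullhomotopicE[_ h].
  exact/loop_class_eq1.
move=> p w q hw ew; apply/(univ _ _ _ hw)/nullhomotopicE.
have [h hp] := deck_transitive C_connected Cs1 A_regular p0 (cpnt A' p).
have hl := joins_over (deck_over h) (valP l); rewrite hp in hl.
have e : map (val h).2 (val l) = map (cseg A') w.
  apply: (lift_uniq (A := A) hl (joins_map A' hw)).
  by rewrite (map_over _ (deck_over h)) el -ew -map_comp.
rewrite -e; split=> //; rewrite -hp.
apply: (deck_homotopic h (w' := [::])).
exact/loop_class_eq1.
Qed.

Lemma principal_class_loop W W' (l l' : loop p0) :
  map (cseg A) (val l) = spell s W -> map (cseg A) (val l') = spell s W' ->
  pc W = pc W' <-> loop_class l = loop_class l'.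
Proof.
move=> e e'; apply: (iff_trans (principal_class_eq _ _ Cs1 _ _)).
have e2 : map (cseg A) (val (loopM (loopV l) l')) = spell s (word_inv W ++ W').
  by rewrite /= map_cat map_path_inv e e' -spell_inv -spell_cat.
apply: (iff_trans (closed_over_loop e2)).
have -> : loop_class (loopM (loopV l) l') = ((loop_class l)^-1 * loop_class l')%g.
  by rewrite /loop_class -(@classV (loop_pre p0)) -(@classM (loop_pre p0)).
split=> [h|->]; last exact: mulVg.
by apply: (mulgI (loop_class l)^-1%g); rewrite h mulVg.
Qed.

(** A loop at p0 is matched with the word that its image in the base spells. *)
Lemma subgroup_isomorphic : isomorphic (subgroup U) (fundamentalGroup p0).
Proof.
apply: (@isomorphic_of_rel (subgroup U) (fundamentalGroup p0)
  (fun u X => exists W (l : loop p0),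
  [/\ map (cseg A) (val l) = spell s W, val u = pc W & X = loop_class l]))
  => [u|X|u X X'|u u' X|u X u' X'].
- have [W eW] := principal_classW (val u).
  have := valP u; rewrite /= eW => /pathSubgroupP[w h e].
  by exists (loop_class (exist (fun w => joins p0 w p0) w h)), W,
    (exist (fun w => joins p0 w p0) w h).
- have [l ->] := classW X.
  have [W eW] := spell_onto (map (cseg A) (val l)) s_orientation.
  have hW : pc W \in U.
    by apply/pathSubgroupP; exists (val l) => //; apply: (valP l).
  by exists (exist (fun x => x \in U) (pc W) hW), W, l.
- move=> [W [l [e eu ->]]] [W' [l' [e' eu' ->]]].
  by apply/(principal_class_loop e e'); rewrite -eu -eu'.
- move=> [W [l [e eu ->]]] [W' [l' [e' eu' el]]].
  by apply: val_inj; rewrite eu eu'; apply/(principal_class_loop e e').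
- move=> [W [l [e eu ->]]] [W' [l' [e' eu' ->]]].
  exists (W ++ W'), (loopM l l'); split.
  + by rewrite map_cat e e' spell_cat.
  + by rewrite principal_classM -eu -eu'.
  + by apply/esym/(@classM (loop_pre p0)).
Qed.

End RegularCoveringOfOnePoint.

(** * The theorem *)

Theorem mainTheorem4
    (C Cs : surfaceComplex) (A : covering C Cs) (p0 : pnt C)
    (C_connected : connected C) (Cs_one_point : one_point Cs)
    (Cs_simply_bounding : simply_bounding Cs) (A_regular : regular A)
    (K : surfaceComplex) (A' : covering K C) (A'_universal : universal A')
    (I : countType) (s : I -> seg Cs) (s_orientation : orientation s) :
  let V := principalGroup (comp_covering A A') s in
  let U : groupClosed V := pathSubgroup A A' s p0 in
  isomorphic (subgroup U) (fundamentalGroup p0) /\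
  exists U_normal : normal U, isomorphic (deckGroup A) (factorGroup U_normal).
Proof.
move=> V U; split; first exact: subgroup_isomorphic.
by eexists; apply: deck_isomorphic.
Qed.
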